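(* The map $\Lambda:\mathcal{P}\to\Pi$, $(P,Q)\mapsto\Lambda(P,Q)$, is surjective and unramified 2:1: for every $(P,Q)\in\mathcal{P}$ the fiber is $\Lambda^{-1}(\Lambda(P,Q))=\{(P,Q),(-P,-Q)\}$, which has exactly two elements.
   Context: A binary quadratic form $[a,b,c]$ ($a,b,c\in\mathbb{Z}$) is identified with the symmetric matrix $\begin{pmatrix}2a&b\\ b&2c\end{pmatrix}$; its discriminant is $b^2-4ac$; all forms are assumed non-degenerate ($b^2-4ac\neq0$), but not necessarily definite or primitive. $-[a,b,c]=[-a,-b,-c]$. Two forms $[a,b,c],[a',b',c']$ are coprime if $\gcd(a,b,c,a',b',c')=1$. $\mathcal{P}$ is the set of ordered pairs $(P,Q)$ of coprime binary quadratic forms of the same discriminant. $\Gamma^e$ is the lattice of $2\times2$ integer matrices with the symmetric bilinear form determined by $\langle X,X\rangle=2\det X$. $\Pi$ is the set of rank 2 sublattices $M\subset\Gamma^e$ such that $\Gamma^e/M$ is torsion free and the restricted form on $M$ is non-degenerate. For $X=\begin{pmatrix}\alpha&\beta\\ \gamma&\delta\end{pmatrix}$, $X^A=\begin{pmatrix}\delta&-\beta\\-\gamma&\alpha\end{pmatrix}$ and $X^t$ is the transpose. $\Lambda(P,Q)=\{X\in\Gamma^e\mid X^tP=QX^A\}$. *)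

(* Defs.v *)
From HB Require Import structures.
From mathcomp Require Import all_boot all_order all_algebra.
From mathcomp Require Import boolp classical_sets functions cardinality.
From mathcomp Require Import ring.

Set Implicit Arguments.
Unset Strict Implicit.
Unset Printing Implicit Defensive.

Import GRing.Theory.

Local Open Scope classical_set_scope.
Local Open Scope ring_scope.

(* BQF a b c is the form [a,b,c] = a x^2 + b x y + c y^2; degenerate forms are
   excluded in [calP], not in the type. *)
Record bqf := BQF { qa : int; qb : int; qc : int }.

Definition disc (P : bqf) : int := qb P ^+ 2 - 4 * qa P * qc P.

Definition nondegenerate (P : bqf) : Prop := disc P <> 0.

Definition bqf_opp (P : bqf) : bqf := BQF (- qa P) (- qb P) (- qc P).

Definition bqf_mx (P : bqf) : 'M[int]_2 :=
  \matrix_(i < 2, j < 2)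
    if i != j then qb P else if i == 0 then 2 * qa P else 2 * qc P.

Definition bqf_coprime (P Q : bqf) : Prop :=
  \big[gcdz/0]_(x <- [:: qa P; qb P; qc P; qa Q; qb Q; qc Q]) x = 1.

Definition calP : set (bqf * bqf) :=
  [set PQ | [/\ nondegenerate PQ.1, nondegenerate PQ.2,
                bqf_coprime PQ.1 PQ.2 & disc PQ.1 = disc PQ.2]].

Fact lift2_0 : lift (0 : 'I_2) 0 = 1. Proof. exact/val_inj. Qed.
Fact lift2_1 : lift (1 : 'I_2) 0 = 0. Proof. exact/val_inj. Qed.

Lemma det_mx2 (X : 'M[int]_2) : \det X = X 0 0 * X 1 1 - X 0 1 * X 1 0.
Proof.
rewrite (expand_det_row _ 0) !big_ord_recl big_ord0 /cofactor !det_mx11 !mxE.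
by rewrite !lift2_0 lift2_1 /=; ring.
Qed.

(* The operation X |-> X^A is the adjugate \adj X. *)
Lemma adj_mx2 (X : 'M[int]_2) :
  [/\ (\adj X) 0 0 = X 1 1, (\adj X) 0 1 = - X 0 1,
      (\adj X) 1 0 = - X 1 0 & (\adj X) 1 1 = X 0 0].
Proof.
by split; rewrite mxE /cofactor det_mx11 !mxE ?lift2_0 ?lift2_1 /=; ring.
Qed.

(* Polarization of the quadratic form det, so that <X, X> = 2 det X. *)
Definition bil (X Y : 'M[int]_2) : int := \det (X + Y) - \det X - \det Y.

Lemma bil_diag X : bil X X = 2 * \det X.
Proof. by rewrite /bil !det_mx2 !mxE; ring. Qed.

Lemma bilC X Y : bil X Y = bil Y X.
Proof. by rewrite /bil addrC (addrC X); ring. Qed.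

Lemma bil_linear n X Y Z : bil (n *: X + Y) Z = n * bil X Z + bil Y Z.
Proof. by rewrite /bil !det_mx2 !mxE; ring. Qed.

(* M is a sublattice of rank r: a subgroup with a Z-basis of r elements. *)
Definition sublattice_of_rank (V : lmodType int) (r : nat) (M : set V) : Prop :=
  exists e : 'I_r -> V,
    (forall k : 'I_r -> int, \sum_i k i *: e i = 0 -> forall i, k i = 0) /\
    M = [set X | exists k : 'I_r -> int, X = \sum_i k i *: e i].

Definition quotient_torsion_free (V : lmodType int) (M : set V) : Prop :=
  forall (n : int) (X : V), n <> 0 -> M (n *: X) -> M X.

Definition bil_nondegenerate_on (M : set 'M[int]_2) : Prop :=
  forall X, M X -> (forall Y, M Y -> bil X Y = 0) -> X = 0.

Definition calPi : set (set 'M[int]_2) :=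
  [set M | [/\ sublattice_of_rank 2 M, quotient_torsion_free M
             & bil_nondegenerate_on M]].

Definition Lambda (PQ : bqf * bqf) : set 'M[int]_2 :=
  [set X | X^T *m bqf_mx PQ.1 = bqf_mx PQ.2 *m \adj X].

(* Main.v *)
Require Import Defs.
From mathcomp Require Import all_boot all_order all_algebra.
From mathcomp Require Import boolp classical_sets functions cardinality.
From mathcomp Require Import ring.

(** Write p_ij = x_i y_j - x_j y_i for the Plucker coordinates of the bivector
    X /\ Y of two integer matrices X, Y with entries numbered 1, 2, 3, 4 along
    the rows.  They form a pair of quadratic forms, [wedge X Y]: up to the
    substitution (u, v) |-> (v, -u) and to sign, these are the determinants of
    the two rows (u, v) X, (u, v) Y and of the two columns X (u, v)^t,
    Y (u, v)^t.  The difference of the discriminants of the two forms is a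
    multiple of the Plucker relation p12 p34 - p13 p24 + p14 p23 = 0, and the
    common discriminant is minus the Gram determinant of (X, Y).

    For (P, Q) = wedge X Y, the four linear equations X^t P = Q X^A on a matrix
    Z say twice that Z /\ X /\ Y = 0.  So Lambda is the inverse of the Plucker
    embedding of the Grassmannian of planes in the four-dimensional space of
    matrices, and the theorem says that a saturated rank 2 lattice is
    determined by, and determines up to sign, its primitive decomposable
    bivector.

    - An integer bivector that satisfies the Plucker relation is decomposable
      over the integers ([plucker_decomposable]), so every pair of forms of
      equal discriminant is a [wedge X Y] ([eq_disc_wedge]).  If the pair is
      coprime, a Bezout relation between its coefficients solves
      Z = k X + l Y explicitly, so Lambda is the lattice spanned by X and Y
      ([Lambda_wedge_span]).
    - Conversely, a basis of a saturated lattice has a coprime wedge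
      ([saturated_basis_coprime]), which gives surjectivity.
    - The discriminant being minus the Gram determinant, nondegenerate forms
      match nondegenerate lattices ([bil_nondegenerate_on_span2]).
    - Two bases of one lattice have wedges that are integer multiples of each
      other, hence equal up to sign ([Lambda_fiber]). *)

Set Implicit Arguments.
Unset Strict Implicit.
Unset Printing Implicit Defensive.

Import GRing.Theory.

Local Open Scope classical_set_scope.
Local Open Scope ring_scope.

(** * Integers and two by two integer matrices *)

Lemma mulz_eq1 (m n : int) : m * n = 1 -> m = 1 \/ m = -1.
Proof.
move=> mn1; have: m \is a GRing.unit.
  by apply/unitrP; exists n; split=> //; rewrite mulrC.
by move=> /orP[/eqP|/eqP]; [left|right].
Qed.

Lemma gcdz_seq_bezout (s : seq int) :
  exists c : nat -> int,
    \sum_(i < size s) c i * s`_i = \big[gcdz/0]_(x <- s) x.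
Proof.
elim: s => [|x s [c IHs]]; first by exists (fun=> 0); rewrite big_ord0 big_nil.
have [u [v uv]] := Bezoutz x (\big[gcdz/0]_(y <- s) y).
exists (fun i => if i is j.+1 then v * c j else u).
rewrite /= big_ord_recl big_cons -uv -IHs mulr_sumr /=.
by congr (_ + _); apply: eq_bigr => i _; rewrite mulrA.
Qed.

Lemma dvdz_gcdz_seq (s : seq int) x :
  x \in s -> (\big[gcdz/0]_(y <- s) y %| x)%Z.
Proof.
elim: s => // y s IHs; rewrite big_cons inE => /orP[/eqP ->|/IHs].
  exact: dvdz_gcdl.
by apply: dvdz_trans; apply: dvdz_gcdr.
Qed.

Lemma mx2P (X Y : 'M[int]_2) :
  X 0 0 = Y 0 0 -> X 0 1 = Y 0 1 -> X 1 0 = Y 1 0 -> X 1 1 = Y 1 1 -> X = Y.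
Proof.
move=> e00 e01 e10 e11; apply/matrixP => i j.
have I2 (k : 'I_2) : k = 0 \/ k = 1.
  by case: k => [[|[|]]] // ?; [left|right]; apply/val_inj.
by case: (I2 i) => ->; case: (I2 j) => ->.
Qed.

Definition mx2 (x y z t : int) : 'M[int]_2 :=
  \matrix_(i < 2, j < 2)
    if i == 0 then (if j == 0 then x else y) else (if j == 0 then z else t).

Lemma bilE X Y :
  bil X Y = X 0 0 * Y 1 1 + X 1 1 * Y 0 0 - X 0 1 * Y 1 0 - X 1 0 * Y 0 1.
Proof. by rewrite /bil !det_mx2 !mxE; ring. Qed.

(** The form [bil] is unimodular, so every linear functional on matrices is
    [bil W] for some W, and primitivity of X' reads bil W X' = 1. *)
Lemma primitive_part (X : 'M[int]_2) :
  exists g X' W, X = g *: X' /\ bil W X' = 1.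
Proof.
pose s := [:: X 0 0; X 0 1; X 1 0; X 1 1].
have [c] := gcdz_seq_bezout s; rewrite !big_ord_recl big_ord0 /=.
have := @dvdz_gcdz_seq s; set g := \big[_/_]_(_ <- _) _ => gs cg.
have [/dvdzP[x0 e0] /dvdzP[x1 e1] /dvdzP[x2 e2] /dvdzP[x3 e3]] :
   [/\ X 0 0 \in dvdz g, X 0 1 \in dvdz g, X 1 0 \in dvdz g & X 1 1 \in dvdz g].
  by split; apply: gs; rewrite !inE eqxx ?orbT.
have [g0|/eqP g0] := pselect (g = 0).
  (* For X = 0 any primitive matrix will do. *)
  exists 0, (mx2 1 0 0 0), (mx2 0 0 0 1); split; last by rewrite bilE !mxE.
  by rewrite scale0r; apply: mx2P; rewrite mxE ?e0 ?e1 ?e2 ?e3 g0 mulr0.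
(* [bil] pairs opposite corners, the antidiagonal ones with a minus sign. *)
exists g, (mx2 x0 x1 x2 x3), (mx2 (c 3) (- c 2) (- c 1%N) (c 0%N)); split.
  by apply: mx2P; rewrite !mxE /= ?e0 ?e1 ?e2 ?e3 mulrC.
apply: (mulfI g0); rewrite mulr1 -[RHS]cg bilE !mxE /= e0 e1 e2 e3 /bump /=.
ring.
Qed.

(** * Coprime pairs and Bezout relations *)

Definition dot (U P : bqf) : int := qa U * qa P + qb U * qb P + qc U * qc P.

(** Coprimality enters every later argument through such a relation: it turns
    an identity between coefficient vectors into one between integers. *)
Lemma bqf_coprimeP P Q :
  bqf_coprime P Q <-> exists U V, dot U P + dot V Q = 1.
Proof.
rewrite /bqf_coprime; set s := [:: _; _; _; _; _; _]; split.
  have [c] := gcdz_seq_bezout s; rewrite !big_ord_recl big_ord0 /= => <- c1.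
  exists (BQF (c 0%N) (c 1%N) (c 2)), (BQF (c 3) (c 4) (c 5)).
  by rewrite -[RHS]c1 /dot /= /bump /=; ring.
move=> [U [V UV]]; have gs := @dvdz_gcdz_seq s.
have g1 : 1 \in dvdz (\big[gcdz/0]_(x <- s) x).
  rewrite -UV /dot.
  by rewrite !rpredD // dvdz_mull //; apply: gs; rewrite !inE eqxx ?orbT.
rewrite /s big_cons in g1 *; move: g1; rewrite dvdz1 /gcdz /=.
by move=> /eqP ->.
Qed.

(** * The pair of forms attached to two matrices *)

(** The form u^2 p34 + u v (p23 - p14) + v^2 p12, that is, the determinant of
    the rows (v, -u) X and (v, -u) Y. *)
Definition wedgeL (X Y : 'M[int]_2) : bqf :=
  BQF (X 1 0 * Y 1 1 - X 1 1 * Y 1 0)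
      ((X 0 1 * Y 1 0 - X 1 0 * Y 0 1) - (X 0 0 * Y 1 1 - X 1 1 * Y 0 0))
      (X 0 0 * Y 0 1 - X 0 1 * Y 0 0).

(** Minus the determinant of the columns X (u, v)^t and Y (u, v)^t. *)
Definition wedgeR (X Y : 'M[int]_2) : bqf :=
  BQF (- (X 0 0 * Y 1 0 - X 1 0 * Y 0 0))
      (- (X 0 0 * Y 1 1 - X 1 1 * Y 0 0) - (X 0 1 * Y 1 0 - X 1 0 * Y 0 1))
      (- (X 0 1 * Y 1 1 - X 1 1 * Y 0 1)).

Definition wedge X Y := (wedgeL X Y, wedgeR X Y).

Lemma disc_wedgeL X Y :
  disc (wedgeL X Y) = bil X Y ^+ 2 - bil X X * bil Y Y.
Proof. by rewrite /disc !bilE /=; ring. Qed.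

Lemma disc_wedgeR X Y :
  disc (wedgeR X Y) = bil X Y ^+ 2 - bil X X * bil Y Y.
Proof. by rewrite /disc !bilE /=; ring. Qed.

(** The four entries of the matrix equation.  With s, d the half sum and half
    difference of the middle coefficients they are twice the rows of a
    skew-symmetric matrix with entries a, c, a', c', s, d up to sign. *)
Lemma LambdaP P Q X : Lambda (P, Q) X <->
  [/\ 2 * qa P * X 0 0 + (qb P + qb Q) * X 1 0 - 2 * qa Q * X 1 1 = 0,
      (qb P - qb Q) * X 0 0 + 2 * qc P * X 1 0 + 2 * qa Q * X 0 1 = 0,
      2 * qa P * X 0 1 + (qb P - qb Q) * X 1 1 + 2 * qc Q * X 1 0 = 0
    & (qb P + qb Q) * X 0 1 + 2 * qc P * X 1 1 - 2 * qc Q * X 0 0 = 0].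
Proof.
have [A00 A01 A10 A11] := adj_mx2 X.
have E i j : (X^T *m bqf_mx P) i j = X 0 i * bqf_mx P 0 j + X 1 i * bqf_mx P 1 j.
  by rewrite mxE !big_ord_recl big_ord0 !lift2_0 !mxE addr0.
have F i j : (bqf_mx Q *m \adj X) i j =
    bqf_mx Q i 0 * (\adj X) 0 j + bqf_mx Q i 1 * (\adj X) 1 j.
  by rewrite mxE !big_ord_recl big_ord0 !lift2_0 addr0.
have EF i j : (X^T *m bqf_mx P) i j - (bqf_mx Q *m \adj X) i j =
   X 0 i * bqf_mx P 0 j + X 1 i * bqf_mx P 1 j -
   (bqf_mx Q i 0 * (\adj X) 0 j + bqf_mx Q i 1 * (\adj X) 1 j).
  by rewrite E F.
split=> [XL|[e1 e2 e3 e4]].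
  have {}EF i j := etrans (esym (EF i j))
    (congr1 (fun M : 'M_2 => M i j - (bqf_mx Q *m \adj X) i j) XL).
  by split; [have := EF 0 0|have := EF 0 1|have := EF 1 0|have := EF 1 1];
     rewrite ?(A00, A01, A10, A11) !mxE /= subrr => <-; ring.
apply: mx2P; apply/eqP; rewrite -subr_eq0; apply/eqP;
  rewrite EF !(A00, A01, A10, A11) !mxE /=.
- by rewrite -[RHS]e1; ring.
- by rewrite -[RHS]e2; ring.
- by rewrite -[RHS]e3; ring.
- by rewrite -[RHS]e4; ring.
Qed.

Lemma Lambda_linear P Q k l X Y : Lambda (P, Q) X -> Lambda (P, Q) Y ->
  Lambda (P, Q) (k *: X + l *: Y).
Proof.
move=> /LambdaP[e1 e2 e3 e4] /LambdaP[f1 f2 f3 f4].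
have z : k * 0 + l * 0 = 0 :> int by rewrite !mulr0 addr0.
apply/LambdaP; rewrite !mxE; split; rewrite -[RHS]z.
- by rewrite -{1}e1 -f1; ring.
- by rewrite -{1}e2 -f2; ring.
- by rewrite -{1}e3 -f3; ring.
- by rewrite -{1}e4 -f4; ring.
Qed.

Lemma Lambda_torsion_free PQ : quotient_torsion_free (Lambda PQ).
Proof.
move=> n X /eqP n0; rewrite /Lambda /= => nX; apply/matrixP => i j.
have adjn : \adj (n *: X) = n *: \adj X.
  have [a00 a01 a10 a11] := adj_mx2 X.
  have [b00 b01 b10 b11] := adj_mx2 (n *: X).
  by apply: mx2P; rewrite [RHS]mxE ?(a00, a01, a10, a11) ?(b00, b01, b10, b11)
    !mxE ?mulrN.
have trn : (n *: X)^T = n *: X^T by apply/matrixP => k l; rewrite !mxE.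
move: nX; rewrite adjn trn -scalemxAl -scalemxAr => nX; apply: (mulfI n0).
by have := congr1 (fun A : 'M_2 => A i j) nX; rewrite !mxE.
Qed.

Lemma Lambda_wedge X Y : Lambda (wedge X Y) X /\ Lambda (wedge X Y) Y.
Proof. by split; apply/LambdaP; rewrite /=; split; ring. Qed.

Definition span2 (X Y : 'M[int]_2) : set 'M[int]_2 :=
  [set Z | exists k l, Z = k *: X + l *: Y].

(** Contracting the trivector Z /\ X /\ Y = 0 with the bivector (U, V) gives
    <UV, X /\ Y> Z = <UV, Z /\ Y> X + <UV, X /\ Z> Y, and the Bezout relation
    makes the coefficient of Z equal to 1. *)
Lemma Lambda_wedge_span X Y : bqf_coprime (wedgeL X Y) (wedgeR X Y) ->
  Lambda (wedge X Y) = span2 X Y.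
Proof.
move=> /bqf_coprimeP[U [V UV]]; apply/seteqP; split=> Z; last first.
  move=> [k [l ->]]; have [LX LY] := Lambda_wedge X Y.
  exact: Lambda_linear LX LY.
move=> /LambdaP[e1 e2 e3 e4].
have half (m n : int) : 2 * m = n -> n = 0 -> m = 0.
  by move=> <- /eqP; rewrite mulf_eq0 /= => /eqP.
(* T is a coordinate of the trivector Z /\ X /\ Y: the 3 x 3 minor on the
   three matrix positions (i, j), (k, l), (m, n). *)
pose T (i j k l m n : 'I_2) := Z i j * (X k l * Y m n - X m n * Y k l)
  - X i j * (Z k l * Y m n - Z m n * Y k l)
  - Y i j * (X k l * Z m n - X m n * Z k l).
have T134 : T 0 0 1 0 1 1 = 0 by apply: half e1; rewrite /T /=; ring.
have T123 : T 0 0 0 1 1 0 = 0 by apply: half e2; rewrite /T /=; ring.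
have T234 : T 0 1 1 0 1 1 = 0 by apply: half e3; rewrite /T /=; ring.
have T124 : T 0 0 0 1 1 1 = 0 by apply: half e4; rewrite /T /=; ring.
exists (dot U (wedgeL Z Y) + dot V (wedgeR Z Y)).
exists (dot U (wedgeL X Z) + dot V (wedgeR X Z)).
(* The functional (U, V) written on the Plucker coordinates. *)
pose v12 := qc U; pose v13 := - qa V; pose v14 := - qb U - qb V.
pose v23 := qb U - qb V; pose v24 := - qc V; pose v34 := qa U.
rewrite -[LHS]scale1r -UV.
apply: mx2P; rewrite !mxE; apply/eqP; rewrite -subr_eq0; apply/eqP.
- transitivity (v23 * T 0 0 0 1 1 0 + v24 * T 0 0 0 1 1 1 + v34 * T 0 0 1 0 1 1).
    by rewrite /v23 /v24 /v34 /T /dot /=; ring.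
  by rewrite T123 T124 T134 !mulr0 !addr0.
- transitivity (v34 * T 0 1 1 0 1 1 - v13 * T 0 0 0 1 1 0 - v14 * T 0 0 0 1 1 1).
    by rewrite /v13 /v14 /v34 /T /dot /=; ring.
  by rewrite T123 T124 T234 !mulr0 !subr0.
- transitivity (v12 * T 0 0 0 1 1 0 - v14 * T 0 0 1 0 1 1 - v24 * T 0 1 1 0 1 1).
    by rewrite /v12 /v14 /v24 /T /dot /=; ring.
  by rewrite T123 T134 T234 !mulr0 !subr0.
- transitivity (v12 * T 0 0 0 1 1 1 + v13 * T 0 0 1 0 1 1 + v23 * T 0 1 1 0 1 1).
    by rewrite /v12 /v13 /v23 /T /dot /=; ring.
  by rewrite T124 T134 T234 !mulr0 !addr0.
Qed.

(** If k X + l Y = 0 then its wedge with Y, which is k (X /\ Y), vanishes;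
    coprimality gives k = 0, and symmetrically l = 0. *)
Lemma coprime_wedge_free X Y k l : bqf_coprime (wedgeL X Y) (wedgeR X Y) ->
  k *: X + l *: Y = 0 -> k = 0 /\ l = 0.
Proof.
move=> /bqf_coprimeP[U [V UV]] kl0.
split.
- transitivity (dot U (wedgeL (k *: X + l *: Y) Y) +
    dot V (wedgeR (k *: X + l *: Y) Y)).
    by rewrite -[LHS]mulr1 -UV /dot /= !mxE; ring.
  by rewrite kl0 /dot /= !mxE; ring.
- transitivity (dot U (wedgeL X (k *: X + l *: Y)) +
    dot V (wedgeR X (k *: X + l *: Y))).
    by rewrite -[LHS]mulr1 -UV /dot /= !mxE; ring.
  by rewrite kl0 /dot /= !mxE; ring.
Qed.

(** * Decomposability *)

(** The Plucker relation makes each row of the skew matrix (p_ij) incident to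
    p, meaning that its wedge with p vanishes.  Let X be the primitive part of
    a nonzero row, and w a functional with w(X) = 1.  Contracting X /\ p = 0
    with w gives p = X /\ Y for Y the contraction of p with w. *)
Lemma plucker_decomposable (p12 p13 p14 p23 p24 p34 : int) :
  p12 * p34 - p13 * p24 + p14 * p23 = 0 ->
  exists X Y : 'M[int]_2,
   [/\ p12 = X 0 0 * Y 0 1 - X 0 1 * Y 0 0,
       p13 = X 0 0 * Y 1 0 - X 1 0 * Y 0 0
     & p14 = X 0 0 * Y 1 1 - X 1 1 * Y 0 0] /\
   [/\ p23 = X 0 1 * Y 1 0 - X 1 0 * Y 0 1,
       p24 = X 0 1 * Y 1 1 - X 1 1 * Y 0 1
     & p34 = X 1 0 * Y 1 1 - X 1 1 * Y 1 0].
Proof.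
move=> plu.
pose incident (X : 'M[int]_2) :=
 [/\ X 0 0 * p23 - X 0 1 * p13 + X 1 0 * p12 = 0,
     X 0 0 * p24 - X 0 1 * p14 + X 1 1 * p12 = 0,
     X 0 0 * p34 - X 1 0 * p14 + X 1 1 * p13 = 0
   & X 0 1 * p34 - X 1 0 * p24 + X 1 1 * p23 = 0].
have [X incX [W WX]] : exists2 X, incident X & exists W, bil W X = 1.
  have prim X0 : incident X0 -> X0 <> 0 ->
      exists2 X, incident X & exists W, bil W X = 1.
    move=> inc0 X00; have [g [X [W [eX WX]]]] := primitive_part X0.
    exists X; last by exists W.
    have g0 : g != 0 by apply/eqP => g0; apply: X00; rewrite eX g0 scale0r.
    by case: inc0; rewrite eX !mxE => i1 i2 i3 i4;
       split; apply: (mulfI g0); rewrite mulr0;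
       [rewrite -[RHS]i1|rewrite -[RHS]i2|rewrite -[RHS]i3|rewrite -[RHS]i4]; ring.
  (* If the first three rows vanish then p = 0, and every X is incident. *)
  pose r1 := mx2 0 p12 p13 p14.
  pose r2 := mx2 (- p12) 0 p23 p24.
  pose r3 := mx2 (- p13) (- p23) 0 p34.
  have [r10|] := pselect (r1 = 0); last first.
    by apply: prim; rewrite /incident !mxE /=; split;
       (ring || rewrite -[RHS]plu; ring).
  have [r20|] := pselect (r2 = 0); last first.
    by apply: prim; rewrite /incident !mxE /=; split;
       (ring || (rewrite -[RHS]oppr0 -plu; ring) || (rewrite -[RHS]plu; ring)).
  have [r30|] := pselect (r3 = 0); last first.
    by apply: prim; rewrite /incident !mxE /=; split;
       (ring || (rewrite -[RHS]oppr0 -plu; ring) || (rewrite -[RHS]plu; ring)).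
  have entry (A : 'M[int]_2) i j : A = 0 -> A i j = 0 by move=> ->; rewrite mxE.
  have := entry _ 0 1 r10; have := entry _ 1 0 r10; have := entry _ 1 1 r10.
  have := entry _ 1 0 r20; have := entry _ 1 1 r20; have := entry _ 1 1 r30.
  rewrite !mxE /= => z34 z24 z23 z14 z13 z12.
  exists (mx2 1 0 0 0); last by exists (mx2 0 0 0 1); rewrite bilE !mxE.
  by rewrite /incident z34 z24 z23 z14 z13 z12 !mulr0 !subr0.
(* The coordinates of the functional [bil W]. *)
pose w1 := W 1 1; pose w2 := - W 1 0; pose w3 := - W 0 1; pose w4 := W 0 0.
pose Y := mx2 (- w2 * p12 - w3 * p13 - w4 * p14) (w1 * p12 - w3 * p23 - w4 * p24)
              (w1 * p13 + w2 * p23 - w4 * p34) (w1 * p14 + w2 * p24 + w3 * p34).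
case: incX => i1 i2 i3 i4.
have contract (p q : int) c1 c2 c3 c4 :
  p * bil W X - q = c1 * (X 0 0 * p23 - X 0 1 * p13 + X 1 0 * p12)
    + c2 * (X 0 0 * p24 - X 0 1 * p14 + X 1 1 * p12)
    + c3 * (X 0 0 * p34 - X 1 0 * p14 + X 1 1 * p13)
    + c4 * (X 0 1 * p34 - X 1 0 * p24 + X 1 1 * p23) -> p = q.
  by rewrite i1 i2 i3 i4 WX mulr1 !mulr0 !addr0 => /eqP; rewrite subr_eq0 => /eqP.
exists X, Y; rewrite !mxE /=; split; split.
- by apply: (contract _ _ w3 w4 0 0); rewrite bilE /w1 /w2 /w3 /w4; ring.
- by apply: (contract _ _ (- w2) 0 w4 0); rewrite bilE /w1 /w2 /w3 /w4; ring.
- by apply: (contract _ _ 0 (- w2) (- w3) 0); rewrite bilE /w1 /w2 /w3 /w4; ring.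
- by apply: (contract _ _ w1 0 0 w4); rewrite bilE /w1 /w2 /w3 /w4; ring.
- by apply: (contract _ _ 0 w1 0 (- w3)); rewrite bilE /w1 /w2 /w3 /w4; ring.
- by apply: (contract _ _ 0 0 w1 w2); rewrite bilE /w1 /w2 /w3 /w4; ring.
Qed.

(** Equal discriminants force b and b' to have the same parity; with
    b = s + d and b' = s - d, equality of the discriminants is the Plucker
    relation for p12 = c, p13 = -a', p14 = -s, p23 = d, p24 = -c', p34 = a. *)
Lemma eq_disc_wedge P Q : disc P = disc Q -> exists X Y, (P, Q) = wedge X Y.
Proof.
case: P Q => [a b c] [a' b' c']; rewrite /disc /= => eD.
have [s [d [eb eb']]] : exists s d, b = s + d /\ b' = s - d.
  have : b - b' \in dvdz 2.
    have : (b - b') ^+ 2 \in dvdz 2.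
      apply/dvdzP; exists ((b - b') * (- b') + 2 * (a * c - a' * c')).
      have -> : (b - b') ^+ 2 = (b ^+ 2 - 4 * a * c) - (b' ^+ 2 - 4 * a' * c')
        + 4 * a * c - 4 * a' * c' - 2 * b' * (b - b') by ring.
      by rewrite eD; ring.
    by rewrite expr2 !dvdzE abszM Euclid_dvdM // => /orP[].
  move=> /dvdzP[d ed]; exists (b' + d), d; split; last by ring.
  by rewrite -(subrK b' b) ed; ring.
have four (m : int) : 4 * m = 0 -> m = 0.
  by move=> /eqP; rewrite mulf_eq0 /= => /eqP.
have := @plucker_decomposable c (- a') (- s) d (- c') a.
case=> [|X [Y [[e12 e13 e14] [e23 e24 e34]]]].
  apply: four; have -> : 4 * (c * a - - a' * - c' + - s * d) =
    (b' ^+ 2 - 4 * a' * c') - (b ^+ 2 - 4 * a * c) by rewrite eb eb'; ring.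
  by rewrite eD subrr.
exists X, Y; rewrite /wedge /wedgeL /wedgeR -e12 -e13 -e14 -e23 -e24 -e34.
by rewrite eb eb' !opprK [d + s]addrC.
Qed.

(** * Saturated lattices *)

(** The hypothesis says that the bivector W /\ W' takes the value 1 on X /\ Y,
    so the Plucker coordinates are coprime.  The forms only involve p14 and p23
    through p23 - p14 and - p14 - p23, which loses a factor 2 a priori.  But
    modulo the ideal I generated by the coefficients, p23 = - p14, so the
    hypothesis becomes 1 = u p14 for an integer u, while the Plucker relation gives
    p14^2 = - p14 p23 = 0; hence 1 = u^2 p14^2 = 0 modulo I. *)
Lemma dual_wedge_coprime X Y W W' :
  bil W X * bil W' Y - bil W Y * bil W' X = 1 ->
  bqf_coprime (wedgeL X Y) (wedgeR X Y).
Proof.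
move=> WW; apply/bqf_coprimeP.
pose p14 := X 0 0 * Y 1 1 - X 1 1 * Y 0 0.
pose w1 := W 1 1; pose w2 := - W 1 0; pose w3 := - W 0 1; pose w4 := W 0 0.
pose w1' := W' 1 1; pose w2' := - W' 1 0; pose w3' := - W' 0 1; pose w4' := W' 0 0.
pose v12 := w1 * w2' - w2 * w1'; pose v13 := w1 * w3' - w3 * w1'.
pose v14 := w1 * w4' - w4 * w1'; pose v23 := w2 * w3' - w3 * w2'.
pose v24 := w2 * w4' - w4 * w2'; pose v34 := w3 * w4' - w4 * w3'.
pose P := wedgeL X Y; pose Q := wedgeR X Y.
(* Eliminating p23 with the middle coefficient of Q: S is the part of the
   relation that lies in the ideal I. *)
pose S := v12 * qc P - v13 * qa Q - v24 * qc Q + v34 * qa P - v23 * qb Q.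
pose u := v14 - v23.
have Su : S + u * p14 = 1.
  rewrite -[RHS]WW !bilE /S /u /v12 /v13 /v14 /v23 /v24 /v34 /P /Q /=.
  by rewrite /w1 /w2 /w3 /w4 /w1' /w2' /w3' /w4' /p14; ring.
have plu : p14 ^+ 2 = - p14 * qb Q - qa Q * qc Q + qc P * qa P.
  by rewrite /P /Q /p14 /=; ring.
(* 1 = (S + u p14)^2 = K S + u^2 p14^2, where both terms lie in I. *)
pose K := S + 2 * u * p14.
exists (BQF (K * v34 + u ^+ 2 * qc P) 0 (K * v12)).
exists (BQF (- K * v13 - u ^+ 2 * qc Q) (- K * v23 - u ^+ 2 * p14) (- K * v24)).
transitivity (K * S + u ^+ 2 * p14 ^+ 2); last first.
  by rewrite -[RHS](expr1n _ 2) -Su /K; ring.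
by rewrite plu /S /dot /=; ring.
Qed.

Lemma sublattice_of_rank2P (M : set 'M[int]_2) :
  sublattice_of_rank 2 M <->
  exists X Y, (forall k l, k *: X + l *: Y = 0 -> k = 0 /\ l = 0) /\
    M = span2 X Y.
Proof.
split=> [[e [free ->]]|[X [Y [free ->]]]].
  exists (e ord0), (e (lift ord0 ord0)); split=> [k l kl0|].
    have /free k0 :
        \sum_i (fun i : 'I_2 => if i == ord0 then k else l) i *: e i = 0.
      by rewrite !big_ord_recl big_ord0 addr0.
    by split; [have := k0 ord0|have := k0 (lift ord0 ord0)].
  apply/seteqP; split=> Z.
    move=> [k ->]; exists (k ord0), (k (lift ord0 ord0)).
    by rewrite !big_ord_recl big_ord0 addr0.
  move=> [k [l ->]]; exists (fun i => if i == ord0 then k else l).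
  by rewrite !big_ord_recl big_ord0 addr0.
exists (fun i => if i == ord0 then X else Y); split=> [k|].
  rewrite !big_ord_recl big_ord0 addr0 /= => /free[k0 k1] i.
  have [->//|] : i = ord0 \/ i = lift ord0 ord0.
    by case: i => [[|[|]]] // ?; [left|right]; apply/val_inj.
  by move=> ->.
apply/seteqP; split=> Z.
  move=> [k [l ->]]; exists (fun i => if i == ord0 then k else l).
  by rewrite !big_ord_recl big_ord0 addr0.
move=> [k ->]; exists (k ord0), (k (lift ord0 ord0)).
by rewrite !big_ord_recl big_ord0 addr0.
Qed.

(** If X = g X' then X' lies in the saturated lattice, so X' = k X + l Y and
    g k = 1 by freeness. *)
Lemma basis_primitive (X Y : 'M[int]_2) :
  (forall k l, k *: X + l *: Y = 0 -> k = 0 /\ l = 0) ->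
  quotient_torsion_free (span2 X Y) ->
  exists W, bil W X = 1.
Proof.
move=> free sat; have [g [X' [W [eX WX]]]] := primitive_part X.
have g0 : g <> 0.
  move=> g0; suff [/eqP] : (1 : int) = 0 /\ (0 : int) = 0 by [].
  by apply: free; rewrite scale0r addr0 scale1r eX g0 scale0r.
have [||k [l eX']] := sat g X' => //.
  by exists 1, 0; rewrite scale0r addr0 scale1r.
have [gk _] : g * k - 1 = 0 /\ g * l = 0.
  apply: free; apply/eqP; rewrite scalerBl scale1r addrAC subr_eq0; apply/eqP.
  by rewrite -!scalerA -scalerDr -eX' -eX.
exists (k *: W); rewrite -[RHS](subrK 1) subrr add0r.
have -> : bil (k *: W) X = k * g * bil W X'.
  by rewrite eX !bilE !mxE; ring.
by rewrite WX mulr1 mulrC; apply/eqP; rewrite -subr_eq0 gk.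
Qed.

(** Take W with bil W X = 1 and replace Y by Y' = Y - (bil W Y) X.  This does
    not change the lattice nor the wedge, and bil W Y' = 0.  As Y' is also part
    of a basis, some W' has bil W' Y' = 1, and the 2 x 2 determinant of the
    values of W, W' on X, Y' is 1. *)
Lemma saturated_basis_coprime (X Y : 'M[int]_2) :
  (forall k l, k *: X + l *: Y = 0 -> k = 0 /\ l = 0) ->
  quotient_torsion_free (span2 X Y) ->
  bqf_coprime (wedgeL X Y) (wedgeR X Y).
Proof.
move=> free sat; have [W WX] := basis_primitive free sat.
pose Y' := Y - bil W Y *: X.
have free' k l : k *: Y' + l *: X = 0 -> k = 0 /\ l = 0.
  move=> kl0; have [] := free (l - k * bil W Y) k.
    by rewrite -[RHS]kl0; apply/matrixP => i j; rewrite !mxE; ring.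
  by move=> /[swap] ->; rewrite mul0r subr0.
have span' : span2 Y' X = span2 X Y.
  apply/seteqP; split=> Z [k [l ->]].
    exists (l - k * bil W Y), k.
    by apply/matrixP => i j; rewrite !mxE; ring.
  exists l, (k + l * bil W Y).
  by apply/matrixP => i j; rewrite !mxE; ring.
have [|W' WY'] := basis_primitive free'; first by rewrite span'.
have -> : wedgeL X Y = wedgeL X Y' by rewrite /wedgeL !mxE; congr BQF; ring.
have -> : wedgeR X Y = wedgeR X Y' by rewrite /wedgeR !mxE; congr BQF; ring.
apply: (@dual_wedge_coprime _ _ W W').
have -> : bil W Y' = bil W Y * (1 - bil W X) by rewrite bilE !mxE !bilE; ring.
by rewrite WX WY' subrr mulr0 mul0r subr0 mulr1.
Qed.

(** * Nondegeneracy *)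

Lemma bil_lincombl k l X Y Z :
  bil (k *: X + l *: Y) Z = k * bil X Z + l * bil Y Z.
Proof. by rewrite !bilE !mxE; ring. Qed.

(** The discriminant of [wedgeL X Y] is minus the determinant of the Gram matrix
    of [bil] on the basis (X, Y). *)
Lemma bil_nondegenerate_on_span2 (X Y : 'M[int]_2) :
  (forall k l, k *: X + l *: Y = 0 -> k = 0 /\ l = 0) ->
  bil_nondegenerate_on (span2 X Y) <-> Defs.nondegenerate (wedgeL X Y).
Proof.
move=> free; rewrite /Defs.nondegenerate disc_wedgeL.
set D := _ - _; split=> [nd D0|/eqP D0 Z [k [l ->]] orth].
  have orthD k l : bil (k *: X + l *: Y) X = 0 -> bil (k *: X + l *: Y) Y = 0 ->
      k = 0 /\ l = 0.
    move=> oX oY; apply: free; apply: nd; first by exists k, l.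
    move=> Z [m [n ->]]; rewrite bilC bil_lincombl.
    by rewrite [bil X _]bilC [bil Y _]bilC oX oY !mulr0 addr0.
  (* A kernel vector of the degenerate Gram matrix; if it is zero then the
     first row of that matrix vanishes and X itself is in the radical. *)
  have [||/eqP] := orthD (bil X Y) (- bil X X); rewrite ?bil_lincombl.
  - by rewrite [bil Y X]bilC; ring.
  - by rewrite -[RHS]D0 /D; ring.
  move=> /eqP XY0 /eqP; rewrite oppr_eq0 => /eqP XX0.
  suff [/eqP] : (1 : int) = 0 /\ (0 : int) = 0 by [].
  by apply: orthD; rewrite bil_lincombl ?XX0 ?XY0 mul0r mulr0 addr0.
have oX : k * bil X X + l * bil X Y = 0.
  rewrite [bil X Y]bilC -bil_lincombl orth //.
  by exists 1, 0; rewrite scale1r scale0r addr0.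
have oY : k * bil X Y + l * bil Y Y = 0.
  rewrite -bil_lincombl orth //.
  by exists 0, 1; rewrite scale1r scale0r add0r.
have k0 : k = 0.
  apply: (mulIf D0); rewrite mul0r.
  have -> : k * D = bil X Y * (k * bil X Y + l * bil Y Y)
     - bil Y Y * (k * bil X X + l * bil X Y) by rewrite /D; ring.
  by rewrite oX oY !mulr0 subr0.
have l0 : l = 0.
  apply: (mulIf D0); rewrite mul0r.
  have -> : l * D = bil X Y * (k * bil X X + l * bil X Y)
     - bil X X * (k * bil X Y + l * bil Y Y) by rewrite /D; ring.
  by rewrite oX oY !mulr0 subr0.
by rewrite k0 l0 !scale0r addr0.
Qed.

(** * The map and its fibers *)

Lemma Lambda_in_calPi : set_fun calP calPi Lambda.
Proof.
move=> [P Q] [/= ndP _ co /eq_disc_wedge[X [Y [eP eQ]]]].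
rewrite {}eP {}eQ -/(wedge X Y) in ndP co *.
have free k l : k *: X + l *: Y = 0 -> k = 0 /\ l = 0.
  exact: coprime_wedge_free.
split; first 1 last.
- exact: Lambda_torsion_free.
- by rewrite Lambda_wedge_span //; apply/bil_nondegenerate_on_span2.
by apply/sublattice_of_rank2P; exists X, Y; rewrite Lambda_wedge_span.
Qed.

Lemma Lambda_surj : set_surj calP calPi Lambda.
Proof.
move=> M [/sublattice_of_rank2P[X [Y [free ->]]] sat nd].
have co := saturated_basis_coprime free sat.
exists (wedge X Y); last by rewrite Lambda_wedge_span.
have ndL := (bil_nondegenerate_on_span2 free).1 nd.
have eD : disc (wedgeL X Y) = disc (wedgeR X Y).
  by rewrite disc_wedgeL disc_wedgeR.
by split=> //=; rewrite /Defs.nondegenerate -eD.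
Qed.

Definition bqf_scale (t : int) (P : bqf) : bqf :=
  BQF (t * qa P) (t * qb P) (t * qc P).

Lemma Lambda_opp P Q : Lambda (bqf_opp P, bqf_opp Q) = Lambda (P, Q).
Proof.
have mxN R : bqf_mx (bqf_opp R) = - bqf_mx R.
  apply/matrixP => i j; rewrite !mxE /=.
  by case: (_ != _) => //; case: (_ == _); rewrite mulrN.
apply/seteqP; split=> X; rewrite /Lambda /= !mxN mulmxN mulNmx.
  exact: oppr_inj.
by move=> ->.
Qed.

Lemma calP_opp P Q : calP (P, Q) -> calP (bqf_opp P, bqf_opp Q).
Proof.
have dN R : disc (bqf_opp R) = disc R by rewrite /disc /=; ring.
move=> [/= ndP ndQ /bqf_coprimeP[U [V UV]] eD].
split; rewrite /Defs.nondegenerate /= ?dN //; apply/bqf_coprimeP.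
by exists (bqf_opp U), (bqf_opp V); rewrite -[RHS]UV /dot /=; ring.
Qed.

(** Writing X' and Y' in the basis (X, Y) multiplies the wedge by the
    determinant of the change of basis. *)
Lemma wedge_Lambda_scale X Y X' Y' :
  bqf_coprime (wedgeL X Y) (wedgeR X Y) ->
  Lambda (wedge X' Y') `<=` Lambda (wedge X Y) ->
  exists t, wedgeL X' Y' = bqf_scale t (wedgeL X Y) /\
            wedgeR X' Y' = bqf_scale t (wedgeR X Y).
Proof.
move=> co sub; have [LX' LY'] := Lambda_wedge X' Y'.
move: (sub _ LX') (sub _ LY'); rewrite Lambda_wedge_span //.
move=> [k [l ->]] [m [n ->]]; exists (k * n - l * m).
by split; rewrite /wedgeL /wedgeR /bqf_scale /= !mxE; congr BQF; ring.
Qed.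

Lemma Lambda_fiber P Q P' Q' : calP (P, Q) -> calP (P', Q') ->
  Lambda (P', Q') = Lambda (P, Q) ->
  (P', Q') = (P, Q) \/ (P', Q') = (bqf_opp P, bqf_opp Q).
Proof.
move=> [/= _ _ co /eq_disc_wedge[X [Y [eP eQ]]]].
move=> [/= _ _ co' /eq_disc_wedge[X' [Y' [eP' eQ']]]].
rewrite {}eP {}eQ {}eP' {}eQ' -/(wedge X Y) -/(wedge X' Y') in co co' * => eL.
have [t [tL tR]] : exists t, wedgeL X' Y' = bqf_scale t (wedgeL X Y) /\
    wedgeR X' Y' = bqf_scale t (wedgeR X Y).
  by apply: wedge_Lambda_scale => //; rewrite eL.
have [t' [tL' tR']] : exists t, wedgeL X Y = bqf_scale t (wedgeL X' Y') /\
    wedgeR X Y = bqf_scale t (wedgeR X' Y').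
  by apply: wedge_Lambda_scale => //; rewrite eL.
have tt' : t * t' = 1.
  have [U [V UV]] := (bqf_coprimeP _ _).1 co.
  rewrite -[RHS]UV tL' tR' tL tR -[LHS]mulr1 -UV /dot /bqf_scale.
  by rewrite tL' tR' tL tR /=; ring.
rewrite /wedge tL tR /bqf_scale /bqf_opp.
by have [->|->] := mulz_eq1 tt'; [left|right]; rewrite ?mul1r ?mulN1r.
Qed.

Theorem theorem6p5 :
  [/\ set_fun calP calPi Lambda,
      set_surj calP calPi Lambda
    & forall P Q : bqf, calP (P, Q) ->
        calP `&` Lambda @^-1` [set Lambda (P, Q)] =
          [set (P, Q); (bqf_opp P, bqf_opp Q)] /\
        (calP `&` Lambda @^-1` [set Lambda (P, Q)] #= `I_2)%card].
Proof.
split; [exact: Lambda_in_calPi|exact: Lambda_surj|move=> P Q PQ].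
have fiber : calP `&` Lambda @^-1` [set Lambda (P, Q)] =
    [set (P, Q); (bqf_opp P, bqf_opp Q)].
  apply/seteqP; split=> [[P' Q'] [/= PQ' eL]|_ [->|->]].
  - by have [->|->] := Lambda_fiber PQ PQ' eL; [left|right].
  - by [].
  - by split; [exact: calP_opp|rewrite /= Lambda_opp].
split=> //; rewrite fiber.
have PN : (P, Q) <> (bqf_opp P, bqf_opp Q).
  move=> [eP _]; case: PQ => /= ndP _ _ _; apply: ndP.
  have z (m : int) : m = - m -> m = 0.
    move=> /eqP; rewrite -subr_eq0 opprK -mulr2n -mulr_natr mulf_eq0 orbF.
    by move=> /eqP.
  rewrite /disc (z _ (congr1 qa eP)) (z _ (congr1 qb eP)).
  by rewrite expr0n mulr0 mul0r subr0.
pose f n := if n is 0 then (P, Q) else (bqf_opp P, bqf_opp Q).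
have <- : f @` `I_2 = [set (P, Q); (bqf_opp P, bqf_opp Q)].
  apply/seteqP; split=> [_ [[|n] _ <-]|_ [->|->]]; [by left|by right| |].
    by exists 0%N.
  by exists 1%N.
apply: inj_card_eq => -[|[|m]] [|[|n]]; rewrite !inE //= => _ _ eq; by case: PN.
Qed.
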